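(* Let $n\in\mathbb{N}$. Let $J:\mathbb{R}\to\mathbb{R}$ satisfy: $J(s)\ge 0$ for all $s\in\mathbb{R}$; $J(0)>0$; $J$ is continuous at $0$; $J\in L^1(\mathbb{R})$ with $\int_{\mathbb{R}}J(s)\,ds=1$. Let $c$ be a nonzero real constant. Let $\mathcal{D}(s)=\mathrm{diag}(d_1(s),\dots,d_n(s))$ with $d_i\in C(\mathbb{R})$ for each $i=1,\dots,n$, and suppose there exist $d_{\max}\ge d_{\min}>0$ such that $d_{\min}\le d_i(s)\le d_{\max}$ for each $i=1,\dots,n$ and each $s\in\mathbb{R}$. Let $P_1$ and $P_2$ be any two $n\times n$ real matrices and let $p=(p_1,\dots,p_n)\in C^1(\mathbb{R};(0,\infty)^n)$ satisfy, componentwise, $$P_1p(s)\le cp'(s)-\mathcal{D}(s)\Big(\int_{\mathbb{R}}J(s-s')p(s')\,ds'-p(s)\Big)\le P_2p(s),\qquad s\in\mathbb{R}.$$ Then there exists a constant $M>0$, depending only on $J$, $c$, $d_{\max}$, $d_{\min}$, $P_1$ and $P_2$ (in particular the same $M$ works for all such $\mathcal{D}$ and $p$), such that the following hold. (a) For all $s\in\mathbb{R}$, $$\frac{1}{|p(s)|_1}\Big|\sum_{i=1}^n p_i'(s)\Big|\le M.$$ (b) For any $r>0$, $$e^{-Mr}\le \frac{|p(\xi+s)|_1}{|p(\xi)|_1}\le e^{Mr}\quad\text{for all }\xi\in\mathbb{R}\text{ and }s\in[-r,r].$$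
   Context: For a vector $v=(v_1,\dots,v_n)$, $|v|_1=\sum_{i=1}^n|v_i|$. Vectors are treated as column vectors in matrix products; inequalities between vectors are componentwise. *)

(* Defs.v *)
From HB Require Import structures.
From mathcomp Require Import all_boot all_order all_algebra.
From mathcomp Require Import all_classical all_reals all_analysis.

Set Implicit Arguments.
Unset Strict Implicit.
Unset Printing Implicit Defensive.

Import Order.TTheory GRing.Theory Num.Theory.
Import numFieldNormedType.Exports.

Local Open Scope classical_set_scope.
Local Open Scope ring_scope.

Definition norm1 (R : realType) (n : nat) (v : 'cV[R]_n) : R :=
  \sum_(i < n) `|v i 0|.

Definition component (R : realType) (n : nat) (p : R -> 'cV[R]_n) (i : 'I_n)
  : R -> R := fun s => p s i 0.

Definition C1 (R : realType) (f : R -> R) : Prop :=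
  (forall s, derivable f s 1) /\ continuous (derive1 f).

(* Here and in [integral_line], the completed measure is used so that measurable
   means Lebesgue measurable; [lebesgue_measure] would restrict [J] to Borel
   functions. *)
Definition L1 (R : realType) (f : R -> R) : Prop :=
  (@completed_lebesgue_measure R).-integrable setT (EFin \o f).

Definition integral_line (R : realType) (f : R -> R) : \bar R :=
  (\int[@completed_lebesgue_measure R]_(x in setT) (f x)%:E)%E.

Definition convolution (R : realType) (J g : R -> R) (s : R) : \bar R :=
  integral_line (fun s' => J (s - s') * g s').

(* The i-th component of c p' - D (J * p - p), where D = diag(d_1, ..., d_n).
   It lives in [\bar R] since the convolution of the nonnegative functions
   [J] and [p_i] is not assumed to be finite: if it is +oo and [d_i] is
   positive, this expression is -oo, so that any lower bound by a real number
   forces the convolution to be finite. *)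
Definition wave_operator (R : realType) (n : nat) (J : R -> R) (c : R)
    (d : 'I_n -> R -> R) (p : R -> 'cV[R]_n) (s : R) (i : 'I_n) : \bar R :=
  ((c * derive1 (component p i) s)%:E
   - (d i s)%:E * (convolution J (component p i) s
                   - (component p i s)%:E))%E.

(* Main.v *)
Require Import Defs.
From HB Require Import structures.
From mathcomp Require Import all_boot all_order all_algebra.
From mathcomp Require Import all_classical all_reals all_analysis.
From mathcomp Require Import measurable_realfun ring lra.

(** The total mass [q = p_1 + ... + p_n] satisfies, up to multiples of [q],
    [dmin * (J * q) <= c q' <= dmax * (J * q)]: sum the hypotheses over [i] and
    bound the sums of the entries of [P1 p] and [P2 p] by multiples of [q].  So
    everything reduces to the bound [J * q <= C q] with [C] independent of [q]
    ([shift_dominated_signed]); part (a) follows at once, and part (b) is the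
    statement that [ln q] is Lipschitz ([log_lipschitz]).

    For that bound take [c > 0], the other sign being its mirror image, so that
    [q' >= a (J * q) - b q] for some [a > 0].  Multiplying by [e^(b x)] turns
    this into [Q' >= a H >= 0] with [Q = e^(b x) q] and [H = e^(b x) (J * q)].
    Thus [Q] is nondecreasing, and so is [H], because
    [H(s) = \int J(y) e^(b y) Q(s - y) dy] ([convolution_shift_le]).  By the mean
    value theorem, [Q] gains at least [h a H(s)] between [s] and [s + h]:
    [h a H(s) <= Q(s + h)].  On the other hand [J] is bounded below near [0], so
    [H(s)] is at least a multiple of [Q(s + 2 h)] ([convolution_ge_itv]).
    Combining the two, [Q(s + 2 h)] is at most a multiple of [Q(s + h)] for
    every [s]: [Q] grows at most by a fixed factor over each step [h].
    Using the first estimate again, [H(s)] is at most a multiple of [Q(s + h)],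
    hence of [Q(s)], which is the claim.

    The convolution is taken over Lebesgue measurable functions; writing it as
    [\int J(y) q(s - y) dy], which moves the dependence on [s] to [q], needs that
    reflections of the line preserve the completed Lebesgue measure. *)

Set Implicit Arguments.
Unset Strict Implicit.
Unset Printing Implicit Defensive.
Import Order.TTheory GRing.Theory Num.Theory.
Import numFieldNormedType.Exports.
Local Open Scope classical_set_scope.
Local Open Scope ring_scope.

(** * Reflections and the completed Lebesgue measure *)

(** The line with its Lebesgue measurable sets, which are by construction the
    Caratheodory measurable sets of the Lebesgue outer measure. *)
Definition lebesgueType (R : realType) : measurableType _ :=
  caratheodory_type (mu_ext (@wlength R idfun)).

Section reflection.
Variable R : realType.
Notation leb := (@lebesgue_measure R).
Notation cleb := (@completed_lebesgue_measure R).
Notation borel := (@measurable _ (measurableTypeR R)).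
Notation lebesgue := (@measurable _ (lebesgueType R)).

Lemma borel_lebesgue (A : set R) : borel A -> lebesgue A.
Proof. by move=> mA; exact: sub_caratheodory. Qed.

Lemma continuous_lebesgue (f : R -> R) : continuous f ->
  measurable_fun [set: lebesgueType R] f.
Proof.
move=> cf _ A mA; apply: borel_lebesgue.
exact: (continuous_measurable_fun cf measurableT mA).
Qed.

Lemma borel_reflect (s : R) (A : set R) :
  borel A -> borel ((fun x : R => s - x) @^-1` A).
Proof.
move=> mA; rewrite -[X in measurable X]setTI.
have mphi : measurable_fun [set: measurableTypeR R]
    (fun x => s - x : measurableTypeR R) by exact: measurable_funB.
exact: mphi.
Qed.

Lemma lebesgue_measure_reflect (s : R) (A : set R) :
  borel A -> leb ((fun x : R => s - x) @^-1` A) = leb A.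
Proof.
move=> mA.
have mphi : measurable_fun [set: measurableTypeR R]
    (fun x => s - x : measurableTypeR R).
  by apply: measurable_funB.
pose mphi_mixin := isMeasurableFun.Build _ _ _ _ _ mphi.
pose phi : {mfun measurableTypeR R >-> measurableTypeR R} :=
  HB.pack (fun x => s - x : measurableTypeR R) mphi_mixin.
rewrite -[LHS]/(pushforward leb phi A).
(* the reflection turns an interval open on the left into one open on the right *)
apply/esym; apply: lebesgue_measure_unique => // _ [[a b] _ <-] /=.
rewrite /pushforward.
have -> : phi @^-1` `]a, b] = [set` `[s - b, s - a[].
  by apply/seteqP; split=> x /=; rewrite !in_itv /=; lra.
rewrite !lebesgue_measure_itv /= !lte_fin.
have -> : (s - b < s - a) = (a < b) by lra.
by case: ifP => // _; rewrite -!EFinB; congr EFin; lra.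
Qed.

Lemma negligible_reflect (s : R) (N : set R) :
  leb.-negligible N -> leb.-negligible ((fun x : R => s - x) @^-1` N).
Proof.
move=> [A [mA A0 NA]]; exists ((fun x : R => s - x) @^-1` A); split.
- exact: borel_reflect.
- by rewrite lebesgue_measure_reflect.
- by move=> x /= /NA.
Qed.

(** Lebesgue sets are Borel sets up to a negligible set, so that a map has only
    to be studied on Borel sets and on negligible ones. *)
Lemma lebesgueP (E : set R) : lebesgue E <-> completed_algebra_gen leb E.
Proof.
by rewrite -g_sigma_completed_algebra_genE completed_caratheodory_measurable.
Qed.

Lemma completed_lebesgue_measureU (A N : set R) :
  borel A -> leb.-negligible N -> cleb (A `|` N) = leb A.
Proof.
move=> mA [B [mB B0 NB]]; apply/eqP; rewrite eq_le; apply/andP; split.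
- apply: (le_trans (outer_measureU2 _ _ _)).
  rewrite -[leRHS]adde0 leeD2l// -B0.
  exact: le_outer_measure.
- exact: le_outer_measure.
Qed.

Lemma measurable_reflect (s : R) :
  measurable_fun [set: lebesgueType R] (fun x => s - x : lebesgueType R).
Proof.
move=> _ E /lebesgueP[A mA [N nN <-]]; rewrite setTI preimage_setU.
apply/lebesgueP; exists ((fun x : R => s - x) @^-1` A).
  exact: borel_reflect.
by exists ((fun x : R => s - x) @^-1` N) => //; exact: negligible_reflect.
Qed.

Lemma completed_measure_reflect (s : R) (E : set R) : lebesgue E ->
  cleb ((fun x : R => s - x) @^-1` E) = cleb E.
Proof.
move=> /lebesgueP[A mA [N nN <-]]; rewrite preimage_setU.
rewrite !completed_lebesgue_measureU//.
- exact: lebesgue_measure_reflect.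
- exact: borel_reflect.
- exact: negligible_reflect.
Qed.

Lemma integral_reflect (s : R) (f : R -> R) :
  measurable_fun [set: lebesgueType R] f -> (forall x, 0 <= f x) ->
  integral_line (fun x => f (s - x)) = integral_line f.
Proof.
move=> mf f0; rewrite /integral_line.
have mphi := measurable_reflect s.
pose mphi_mixin := isMeasurableFun.Build _ _ _ _ _ mphi.
pose phi : {mfun lebesgueType R >-> lebesgueType R} :=
  HB.pack (fun x => s - x : lebesgueType R) mphi_mixin.
transitivity (\int[pushforward cleb phi]_(x in setT) (f x)%:E)%E.
  rewrite (ge0_integral_pushforward mphi)//; first exact/measurable_EFinP.
  by move=> x _; rewrite lee_fin.
apply: (@eq_measure_integral _ (lebesgueType R)) => A mA _.
exact: completed_measure_reflect.
Qed.
End reflection.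

(** * Convolution with a nonnegative kernel *)

Section convolution.
Variables (R : realType) (J : R -> R).
Hypothesis mJ : measurable_fun [set: lebesgueType R] J.
Hypothesis J_ge0 : forall s, 0 <= J s.

Lemma measurable_convolution_integrand (q : R -> R) (s : R) : continuous q ->
  measurable_fun [set: lebesgueType R] (fun x => J (s - x) * q x).
Proof.
move=> cq; apply: (@measurable_funM _ (lebesgueType R)).
  exact: (measurableT_comp mJ (measurable_reflect s)).
exact: continuous_lebesgue.
Qed.

Lemma measurable_reflected_integrand (q : R -> R) (s : R) : continuous q ->
  measurable_fun [set: lebesgueType R] (fun y => J y * q (s - y)).
Proof.
move=> cq; apply: (@measurable_funM _ (lebesgueType R)) => //.
apply: continuous_lebesgue => x.
by apply: continuous_comp; [apply: cvgB => //; exact: cvg_cst|exact: cq].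
Qed.

Lemma convolutionE (q : R -> R) (s : R) :
  continuous q -> (forall x, 0 <= q x) ->
  convolution J q s = integral_line (fun y => J y * q (s - y)).
Proof.
move=> cq q0; rewrite -(integral_reflect s).
- by rewrite /integral_line; apply: eq_integral => x _; rewrite subKr.
- exact: measurable_reflected_integrand.
- by move=> x; rewrite mulr_ge0.
Qed.

Lemma convolution_ge0 (q : R -> R) (s : R) :
  (forall x, 0 <= q x) -> (0 <= convolution J q s)%E.
Proof.
by move=> q0; apply: integral_ge0 => x _; rewrite lee_fin mulr_ge0.
Qed.

Lemma convolution_sum n (p : 'I_n -> R -> R) (s : R) :
  (forall i, continuous (p i)) -> (forall i x, 0 <= p i x) ->
  convolution J (fun x => \sum_(i < n) p i x) s =
  (\sum_(i < n) convolution J (p i) s)%E.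
Proof.
move=> cp p0; rewrite /convolution /integral_line.
under eq_integral do rewrite mulr_sumr -sumEFin.
rewrite (@ge0_integral_sum _ (lebesgueType R))//.
- by move=> i; apply/measurable_EFinP; exact: measurable_convolution_integrand.
- by move=> i x _; rewrite lee_fin mulr_ge0.
Qed.

(** Convolution commutes with translations and is monotone.  With [q e^(b x)]
    nondecreasing and [k = e^(b (t - s))], this makes [(J * q) e^(b x)]
    nondecreasing as well. *)
Lemma convolution_shift_le (q : R -> R) (k s t : R) :
  continuous q -> (forall x, 0 <= q x) -> 0 <= k ->
  (forall x, q x <= k * q (x + (t - s))) ->
  (convolution J q s <= k%:E * convolution J q t)%E.
Proof.
move=> cq q0 k0 qk; rewrite !convolutionE//.
have mq := measurable_reflected_integrand _ cq.
rewrite /integral_line -(@ge0_integralZl_EFin _ (lebesgueType R))//.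
- apply: (@ge0_le_integral _ (lebesgueType R)) => //.
  + by move=> x _; rewrite lee_fin mulr_ge0.
  + by apply/measurable_EFinP; exact: mq.
  + by apply: measurable_funeM; apply/measurable_EFinP; exact: mq.
  + move=> x _; rewrite -EFinM lee_fin mulrCA ler_wpM2l//.
    apply: (le_trans (qk _)); rewrite ler_wpM2l//.
    by have -> : s - x + (t - s) = t - x by lra.
- by move=> x _; rewrite lee_fin mulr_ge0.
- by apply/measurable_EFinP; exact: mq.
Qed.

Lemma convolution_ge_itv (q : R -> R) (s j m a b : R) :
  continuous q -> (forall x, 0 <= q x) -> 0 <= j -> 0 <= m -> a < b ->
  (forall x, a <= x <= b -> j <= J (s - x)) ->
  (forall x, a <= x <= b -> m <= q x) ->
  ((j * m * (b - a))%:E <= convolution J q s)%E.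
Proof.
move=> cq q0 j0 m0 ab jJ mq.
have mI : @measurable _ (lebesgueType R) (`[a, b]%classic : set R).
  by apply: borel_lebesgue; exact: measurable_itv.
have mf : measurable_fun [set: lebesgueType R] (EFin \o (fun x => J (s - x) * q x)).
  by apply/measurable_EFinP; exact: measurable_convolution_integrand.
have f0 x : (0 <= (J (s - x) * q x)%:E)%E by rewrite lee_fin mulr_ge0.
apply: (@le_trans _ _ (\int[@completed_lebesgue_measure R]_(x in `[a, b]%classic)
    (J (s - x) * q x)%:E)%E); last first.
  exact: (@ge0_subset_integral _ (lebesgueType R)).
have <- : (\int[@completed_lebesgue_measure R]_(x in `[a, b]%classic)
    (cst (j * m)%:E x))%E = (j * m * (b - a))%:E.
  rewrite (@integral_cst _ (lebesgueType R))//.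
  rewrite [RHS]EFinM; congr (_ * _)%E.
  transitivity (@lebesgue_measure R `[a, b]%classic) => //.
  by rewrite lebesgue_measure_itv /= lte_fin ab.
apply: (@ge0_le_integral _ (lebesgueType R)) => //.
- by move=> x _; rewrite lee_fin mulr_ge0.
- exact: (@measurable_funS _ _ (lebesgueType R) _ setT).
- move=> x /= /[!in_itv]/= xab; rewrite lee_fin.
  by apply: ler_pM => //; [exact: jJ|exact: mq].
Qed.

End convolution.

(** * Differential inequalities on the line *)

Section calculus.
Variable R : realType.
Implicit Types (f df q dq G : R -> R).

Lemma mean_value_line f df (a b : R) :
  (forall x : R, is_derive x 1 f (df x)) -> a <= b ->
  exists2 c, a <= c & f b - f a = df c * (b - a).
Proof.
move=> fdf ab; have cf : {within `[a, b], continuous f}.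
  by apply: derivable_within_continuous => x _; apply: ex_derive.
have [c] := MVT_segment ab (fun x _ => fdf x) cf.
by rewrite in_itv /= => /andP[ac _]; exists c.
Qed.

(** The integrating factor [e^(b x)] absorbs the term [b q] of [q' + b q]. *)
Lemma is_derive_expRM q dq (b x : R) : is_derive x 1 q (dq x) ->
  is_derive x 1 (fun y => expR (b * y) * q y) (expR (b * x) * (dq x + b * q x)).
Proof.
move=> qdq.
have lE : is_derive x 1 ( *%R b : R -> R) b.
  by apply: is_derive_eq (@is_deriveZ R R R id b x 1 1 _) (mulr1 b).
have eE : is_derive x 1 (expR \o *%R b) (expR (b * x) * b).
  exact: is_derive1_comp.
apply: is_derive_eq (is_deriveM eE qdq) _.
by rewrite /GRing.scale /=; ring.
Qed.

Lemma nondecreasing_line f df :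
  (forall x : R, is_derive x 1 f (df x)) -> (forall x, 0 <= df x) ->
  forall x y, x <= y -> f x <= f y.
Proof.
move=> fdf df0 x y xy; have [c _] := mean_value_line fdf xy.
by move=> e; rewrite -subr_ge0 e mulr_ge0 ?subr_ge0.
Qed.

(** The Harnack-type estimate, with [J * q] replaced by any function [G] which
    satisfies the two properties of a convolution that matter: a local lower
    bound, by values of [q] strictly to the right of the point, and compatibility
    with translations.  Values of [q] to the left of the point would give
    nothing: [e^(b x) q] is nondecreasing, so only its growth is in question. *)
Lemma shift_dominated (a b k d : R) :
  0 < a -> 0 <= b -> 0 < k -> 0 < d ->
  exists2 C : R, 0 < C & forall q dq G,
    (forall x : R, is_derive x 1 q (dq x)) -> (forall x, 0 < q x) ->
    (forall x, a * G x - b * q x <= dq x) ->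
    (forall s m : R, 0 <= m -> (forall x : R, s + d <= x <= s + d *+ 2 -> m <= q x) ->
      k * m <= G s) ->
    (forall s t l : R, 0 <= l -> (forall x, q x <= l * q (x + (t - s))) ->
      G s <= l * G t) ->
    forall s, G s <= C * q s.
Proof.
move=> a0 b0 k0 d0.
(* with a step of half the distance [d], the gain on [x - h, x] controls [Q (x + h)] *)
pose h := d / 2; have h0 : 0 < h by rewrite divr_gt0.
pose ha := h * a; have ha0 : 0 < ha by rewrite mulr_gt0.
(* the factor by which the weight [e^(b x)] varies over a distance [2 d] *)
pose k' := k * expR (- (b * (d *+ 2))).
have k'0 : 0 < k' by rewrite mulr_gt0 ?expR_gt0.
exists (ha ^-1 * (ha^-1 * k'^-1)); first by rewrite !mulr_gt0 ?invr_gt0.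
move=> q dq G qdq q0 dq_ge Glow Gshift s.
pose Q x := expR (b * x) * q x.
pose H x := expR (b * x) * G x.
have QdQ (x : R) : is_derive x 1 Q (expR (b * x) * (dq x + b * q x)).
  exact: is_derive_expRM.
have G0 x : 0 <= G x.
  rewrite -(mulr0 k); apply: Glow => // y _; exact/ltW.
have dQ x : a * H x <= expR (b * x) * (dq x + b * q x).
  rewrite /H mulrCA ler_wpM2l ?expR_ge0//; have := dq_ge x; lra.
have H0 x : 0 <= H x by rewrite mulr_ge0 ?expR_ge0.
have Qnd x y : x <= y -> Q x <= Q y.
  apply: (nondecreasing_line QdQ) => z; apply: (le_trans _ (dQ z)).
  by rewrite mulr_ge0 // ltW.
have qQ x : q x = expR (- (b * x)) * Q x by rewrite /Q mulrA -expRD addNr expR0 mul1r.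
have Hnd x y : x <= y -> H x <= H y.
  move=> xy; rewrite /H.
  have -> : expR (b * y) = expR (b * x) * expR (b * (y - x)).
    by rewrite -expRD; congr expR; ring.
  rewrite -mulrA ler_wpM2l ?expR_ge0//; apply: Gshift; first exact: expR_ge0.
  move=> z; rewrite !qQ mulrA -expRD.
  have -> : b * (y - x) - b * (z + (y - x)) = - (b * z) by ring.
  by rewrite ler_wpM2l ?expR_ge0 // Qnd//; lra.
have Hlow x : k' * Q (x + d) <= H x.
  rewrite /H.
  have -> : k' * Q (x + d) =
      expR (b * x) * (k * (expR (- (b * (x + d *+ 2))) * Q (x + d))).
    have -> : - (b * (x + d *+ 2)) = - (b * x) + - (b * (d *+ 2)) by ring.
    rewrite expRD /k'.
    transitivity ((expR (b * x) * expR (- (b * x))) *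
      (k * expR (- (b * (d *+ 2))) * Q (x + d))); last by ring.
    by rewrite -expRD subrr expR0 mul1r.
  rewrite ler_wpM2l ?expR_ge0//; apply: Glow.
    by rewrite mulr_ge0 ?expR_ge0// mulr_ge0 ?expR_ge0// ltW.
  move=> y /andP[y1 y2]; rewrite (qQ y); apply: ler_pM; rewrite ?expR_ge0//.
  - by rewrite mulr_ge0 ?expR_ge0// ltW.
  - by rewrite ler_expR lerN2 ler_wpM2l.
  - exact: Qnd.
have Qgain x : ha * H x <= Q (x + h).
  have xh : x <= x + h by lra.
  have [c xc e] := mean_value_line QdQ xh.
  have Qx : 0 < Q x by rewrite mulr_gt0 ?expR_gt0.
  have : ha * H x <= Q (x + h) - Q x.
    rewrite e; have -> : x + h - x = h by ring.
    rewrite /ha -mulrA mulrC ler_wpM2r ?(ltW h0)//.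
    by apply: le_trans (dQ c); rewrite ler_wpM2l ?(ltW a0) ?Hnd.
  lra.
have Qharnack x : Q (x + h) <= ha^-1 * k'^-1 * Q x.
  have e : x + h = (x - h) + d by rewrite /h; lra.
  have := Qgain (x - h); rewrite subrK => g.
  have := Hlow (x - h); rewrite -e => l.
  rewrite -invfM ler_pdivlMl; last exact: mulr_gt0 ha0 k'0.
  apply: le_trans g; rewrite -mulrA ler_wpM2l ?(ltW ha0)//.
have : H s <= ha^-1 * (ha^-1 * k'^-1) * Q s.
  rewrite -mulrA ler_pdivlMl//; apply: le_trans (Qharnack s); exact: Qgain.
by rewrite /H /Q mulrCA ler_pM2l ?expR_gt0.
Qed.

Lemma is_derive_reflect q dq (x : R) : is_derive (- x) 1 q (dq (- x)) ->
  is_derive x 1 (fun y => q (- y)) (- dq (- x)).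
Proof.
move=> qdq; rewrite -mulrN1.
by apply: (@is_derive1_comp R q -%R); exact: is_deriveNid.
Qed.

(** When [c < 0] the information propagates to the left; reflecting the line
    exchanges the two cases.  Hence the lower bound on [G] is required on both
    sides of [s]. *)
Lemma shift_dominated_signed (a b k d c : R) :
  0 < a -> 0 <= b -> 0 < k -> 0 < d -> c != 0 ->
  exists2 C : R, 0 < C & forall q dq G,
    (forall x : R, is_derive x 1 q (dq x)) -> (forall x, 0 < q x) ->
    (forall x, a * G x - b * q x <= c * dq x) ->
    (forall s u m : R, 0 <= m -> s - d *+ 2 <= u -> u + d <= s + d *+ 2 ->
      (forall x : R, u <= x <= u + d -> m <= q x) -> k * m <= G s) ->
    (forall s t l : R, 0 <= l -> (forall x, q x <= l * q (x + (t - s))) ->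
      G s <= l * G t) ->
    forall s, G s <= C * q s.
Proof.
move=> a0 b0 k0 d0 c0.
have nc0 : 0 < `|c| by rewrite normr_gt0.
have [||||C C0 HC] := @shift_dominated (a / `|c|) (b / `|c|) k d => //.
- exact: divr_gt0.
- by rewrite divr_ge0.
exists C => // q dq G qdq q0 dq_ge Glow Gshift s.
have dq_ge' x : a / `|c| * G x - b / `|c| * q x <= Num.sg c * dq x.
  rewrite mulrAC [X in _ - X]mulrAC -mulrBl ler_pdivrMr//.
  by rewrite mulrAC -numEsg.
have [cneg|cpos|/eqP] := ltgtP c 0; last by rewrite (negbTE c0).
- have -> : s = - - s by rewrite opprK.
  pose q' (x : R) := q (- x); pose dq' (x : R) := - dq (- x).
  pose G' (x : R) := G (- x); rewrite -/(q' (- s)) -/(G' (- s)).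
  apply: (HC q' dq' G') => //.
  + by move=> x; exact: is_derive_reflect.
  + by move=> x; exact: q0.
  + by move=> x; have := dq_ge' (- x); rewrite ltr0_sg// mulN1r.
  + move=> t m m0 qm; apply: (Glow _ (- t - d *+ 2)) => //; first lra.
    move=> x xt; rewrite -(opprK x); apply: qm; lra.
  + move=> t u l l0 ql; apply: Gshift => // x.
    have := ql (- x); rewrite /q' opprK.
    by have -> : - (- x + (u - t)) = x + (- u - - t) by ring.
- apply: (HC q dq G) => //.
  + by move=> x; have := dq_ge' x; rewrite gtr0_sg// mul1r.
  + move=> t m m0 qm; apply: (Glow _ (t + d)) => //; try lra.
    move=> x xt; apply: qm; lra.
Qed.

(** Both [e^(M x) q] and [- e^(- M x) q] are nondecreasing. *)
Lemma log_lipschitz q dq (M : R) :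
  (forall x : R, is_derive x 1 q (dq x)) -> (forall x, 0 < q x) ->
  (forall x, `|dq x| <= M * q x) ->
  forall x y, q y <= expR (M * `|y - x|) * q x.
Proof.
move=> qdq q0 Mq.
have expRM_move (u v : R) A B : expR u * A <= expR v * B -> A <= expR (v - u) * B.
  move=> h; rewrite -(ler_pM2l (expR_gt0 u)) mulrA -expRD.
  by rewrite addrC subrK.
have up x y : x <= y -> q x <= expR (M * y - M * x) * q y.
  move=> xy; apply: expRM_move.
  apply: (nondecreasing_line (fun z => is_derive_expRM M (qdq z))) => // z.
  rewrite mulr_ge0 ?expR_ge0//; have := Mq z; rewrite ler_norml; lra.
have down x y : x <= y -> q y <= expR (M * y - M * x) * q x.
  move=> xy; have -> : M * y - M * x = - M * x - - M * y by ring.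
  apply: expRM_move; rewrite -lerN2 -!mulrN.
  pose nq (z : R) := - q z; pose dnq (z : R) := - dq z.
  have nqdnq (z : R) : is_derive z 1 nq (dnq z) by exact: is_deriveN.
  apply: (nondecreasing_line (fun z => is_derive_expRM (- M) (nqdnq z))) => // z.
  by rewrite mulr_ge0 ?expR_ge0//; have := Mq z; rewrite ler_norml /dnq /nq; lra.
move=> x y; have [xy|yx] := leP x y.
- by rewrite ger0_norm ?subr_ge0// mulrBr; exact: down.
- by rewrite ltr0_norm ?subr_lt0// opprB mulrBr; apply: up; exact: ltW.
Qed.

End calculus.

(** * Total mass of a wave *)

(** An infinite convolution would make the operator equal to [-oo], against the
    real lower bound. *)
Lemma wave_bounds (R : realType) (C : \bar R) (u1 u2 x e y : R) :
  (0 <= C)%E -> 0 < e ->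
  (u1%:E <= x%:E - e%:E * (C - y%:E))%E -> (x%:E - e%:E * (C - y%:E) <= u2%:E)%E ->
  exists2 g : R, C = g%:E & u1 <= x - e * (g - y) <= u2.
Proof.
case: C => [g|_ e0|//]; last by rewrite addye// gt0_muley ?lte_fin.
by move=> _ _ h1 h2; exists g => //; apply/andP; split; rewrite -lee_fin.
Qed.

Definition entry_sum (R : realType) n (P : 'M[R]_n) : R :=
  \sum_i \sum_j `|P i j|.

Lemma norm_sum_mulmx (R : realType) n (P : 'M[R]_n) (v : 'cV[R]_n) :
  (forall i, 0 <= v i 0) ->
  `|\sum_i (P *m v) i 0| <= entry_sum P * \sum_i v i 0.
Proof.
move=> v0; rewrite /entry_sum mulr_suml.
apply: (le_trans (ler_norm_sum _ _ _)); apply: ler_sum => i _.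
rewrite mxE mulr_suml; apply: (le_trans (ler_norm_sum _ _ _)).
apply: ler_sum => j _; rewrite normrM ler_wpM2l// ger0_norm//.
by rewrite (bigD1 j)//= lerDl sumr_ge0.
Qed.

Lemma entry_sum_ge0 (R : realType) n (P : 'M[R]_n) : 0 <= entry_sum P.
Proof. by apply: sumr_ge0 => i _; apply: sumr_ge0 => j _. Qed.

Theorem theorem1 (R : realType) (n : nat) (J : R -> R) (c dmin dmax : R)
    (P1 P2 : 'M[R]_n)
    (n_gt0 : (0 < n)%N)
    (J_ge0 : forall s, 0 <= J s)
    (J0_gt0 : 0 < J 0)
    (J_cont0 : {for 0, continuous J})
    (J_L1 : L1 J)
    (J_int1 : integral_line J = 1%:E)
    (c_neq0 : c != 0)
    (dmin_gt0 : 0 < dmin)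
    (dmin_le_dmax : dmin <= dmax) :
  exists2 M : R, 0 < M &
    forall (d : 'I_n -> R -> R) (p : R -> 'cV[R]_n),
      (forall i, continuous (d i)) ->
      (forall i s, dmin <= d i s <= dmax) ->
      (forall i, C1 (component p i)) ->
      (forall i s, 0 < component p i s) ->
      (forall s i,
         (((P1 *m p s) i 0)%:E <= wave_operator J c d p s i)%E /\
         (wave_operator J c d p s i <= ((P2 *m p s) i 0)%:E)%E) ->
      (forall s : R,
         (norm1 (p s))^-1 * `|\sum_(i < n) derive1 (component p i) s| <= M)
      /\
      (forall r : R, 0 < r ->
         forall xi s : R, s \in `[- r, r] ->
           expR (- (M * r)) <= norm1 (p (xi + s)) / norm1 (p xi)
           /\ norm1 (p (xi + s)) / norm1 (p xi) <= expR (M * r)).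
Proof.
have mJ : measurable_fun [set: lebesgueType R] J.
  by apply/measurable_EFinP; case/integrableP: J_L1.
(* a positive lower bound for [J] near 0 *)
have [w w0 Jw] : exists2 w : R, 0 < w & forall y, `|y| <= w *+ 2 -> J 0 / 2 <= J y.
  have /nbhs_ballP[e /= e0 He] : \forall y \near (0 : R), J 0 / 2 < J y.
    by move/cvgr_gt: J_cont0; apply; lra.
  exists (e / 3); first by rewrite divr_gt0.
  move=> y yw; apply/ltW/He; rewrite /ball /= sub0r normrN; lra.
pose A1 := entry_sum P1; pose A2 := entry_sum P2.
have A10 : 0 <= A1 := entry_sum_ge0 P1.
have A20 : 0 <= A2 := entry_sum_ge0 P2.
have dmax0 : 0 < dmax by exact: lt_le_trans dmin_le_dmax.
have c0 : 0 < `|c| by rewrite normr_gt0.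
have b0 : 0 <= dmax + A1 by lra.
have k0 : 0 < w * (J 0 / 2) by rewrite mulr_gt0// divr_gt0.
have [C C0 HC] := shift_dominated_signed dmin_gt0 b0 k0 w0 c_neq0.
pose N := dmax * C + dmax + A1 + A2.
have N0 : 0 < N by have := mulr_gt0 dmax0 C0; rewrite /N; lra.
exists (N / `|c|); first exact: divr_gt0.
move=> d p _ d_bd p_C1 p_gt0 Hp.
(* the total mass, its derivative and, below, its convolution with [J] *)
pose q x := \sum_(i < n) component p i x.
pose dq x := \sum_(i < n) derive1 (component p i) x.
have p_der i (x : R) : is_derive x 1 (component p i) (derive1 (component p i) x).
  by rewrite derive1E; apply: derivableP; exact: (p_C1 i).1.
have p_cont i : continuous (component p i).
  move=> x; apply/differentiable_continuous/derivable1_diffP; exact: (p_C1 i).1.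
have q_der (x : R) : is_derive x 1 q (dq x).
  rewrite /q (_ : (fun _ => _) = \sum_(i < n) component p i).
    exact: is_derive_sum.
  by apply/funext => y; rewrite fct_sumE.
have q_cont : continuous q.
  by move=> x; apply/differentiable_continuous/derivable1_diffP.
have normq x : norm1 (p x) = q x.
  by apply: eq_bigr => i _; rewrite gtr0_norm//; exact: p_gt0.
have q_gt0 x : 0 < q x.
  rewrite /q (bigD1 (Ordinal n_gt0))//= ltr_wpDr// sumr_ge0// => i _.
  exact: ltW.
pose G s := fine (convolution J q s).
have /all_sig2[g gE g_bd] s : {g : 'I_n -> R |
    forall i, convolution J (component p i) s = (g i)%:E &
    forall i, (P1 *m p s) i 0 <=
       c * derive1 (component p i) s - d i s * (g i - component p i s)
       <= (P2 *m p s) i 0}.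
  apply: cid2.
  have /choice[g gP] : forall i, exists g,
      convolution J (component p i) s = g%:E /\
      (P1 *m p s) i 0 <=
        c * derive1 (component p i) s - d i s * (g - component p i s)
        <= (P2 *m p s) i 0.
    move=> i; have [h1 h2] := Hp s i.
    have di0 : 0 < d i s.
      by have /andP[dmin_le _] := d_bd i s; exact: lt_le_trans dmin_le.
    have cv0 : (0 <= convolution J (component p i) s)%E.
      by apply: convolution_ge0 => // x; exact: ltW.
    by have [g gE g_bd] := wave_bounds cv0 di0 h1 h2; exists g.
  by exists g => i; case: (gP i).
have convq s : convolution J q s = (G s)%:E.
  rewrite /G /q convolution_sum//; last by move=> i x; exact: ltW.
  by rewrite (eq_bigr (fun i => (g s i)%:E)) ?sumEFin.
have GE s : G s = \sum_i g s i.
  apply: EFin_inj; rewrite -convq convolution_sum//; last by move=> i x; exact: ltW.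
  by rewrite -sumEFin; apply: eq_bigr => i _.
have g_ge0 s i : 0 <= g s i.
  rewrite -lee_fin -gE; apply: convolution_ge0 => // x; exact: ltW.
have mx_bd (P : 'M[R]_n) s : `|\sum_i (P *m p s) i 0| <= entry_sum P * q s.
  by apply: norm_sum_mulmx => i; exact/ltW/p_gt0.
(* [d_i (J * p_i)] is bounded below with [dmin], and [- d_i p_i] with [dmax] *)
have lower s : dmin * G s - (dmax + A1) * q s <= c * dq s.
  have := mx_bd P1 s; rewrite ler_norml => /andP[h _].
  apply: (@le_trans _ _ (dmin * G s - dmax * q s + \sum_i (P1 *m p s) i 0)).
    rewrite -/A1 in h; lra.
  rewrite GE /q /dq !mulr_sumr -sumrB -big_split /=; apply: ler_sum => i _.
  have /andP[? _] := g_bd s i; have /andP[d1 d2] := d_bd i s.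
  have := ler_wpM2r (g_ge0 s i) d1; have := ler_wpM2r (ltW (p_gt0 i s)) d2; lra.
have upper s : c * dq s <= dmax * G s + A2 * q s.
  have := mx_bd P2 s; rewrite ler_norml => /andP[_ h].
  apply: (@le_trans _ _ (dmax * G s + \sum_i (P2 *m p s) i 0)); last first.
    by rewrite lerD2l.
  rewrite GE /dq !mulr_sumr -big_split /=; apply: ler_sum => i _.
  have /andP[_ ?] := g_bd s i; have /andP[d1 d2] := d_bd i s.
  have := ler_wpM2r (g_ge0 s i) d2.
  have := mulr_ge0 (le_trans (ltW dmin_gt0) d1) (ltW (p_gt0 i s)); lra.
have G_le s : G s <= C * q s.
  apply: (HC q dq G) => //.
  - move=> t u m m0 u1 u2 qm; rewrite -lee_fin -convq.
    apply: le_trans (convolution_ge_itv (a := u) (b := u + w) (j := J 0 / 2)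
      mJ J_ge0 q_cont _ _ m0 _ _ qm); last 4 first.
    + by move=> x; exact: ltW.
    + lra.
    + lra.
    + by move=> x xu; apply: Jw; rewrite ler_norml; lra.
    rewrite lee_fin le_eqVlt; apply/orP; left; apply/eqP; ring.
  - move=> t u l l0 ql; rewrite -lee_fin EFinM -!convq.
    by apply: convolution_shift_le => // x; exact: ltW.
have G_ge0 s : 0 <= G s by rewrite GE sumr_ge0.
have dq_le s : `|dq s| <= N / `|c| * q s.
  rewrite mulrAC ler_pdivlMr// mulrC -normrM ler_norml /N.
  have dG0 : 0 <= dmin * G s by rewrite mulr_ge0// ltW.
  have dGC : dmax * G s <= dmax * (C * q s) by rewrite ler_wpM2l ?(ltW dmax0).
  have dCq0 : 0 <= dmax * (C * q s).
    by apply: le_trans dGC; rewrite mulr_ge0// ltW.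
  have A1q : 0 <= A1 * q s by rewrite mulr_ge0// ltW.
  have A2q : 0 <= A2 * q s by rewrite mulr_ge0// ltW.
  have dq0 : 0 <= dmax * q s by rewrite mulr_ge0 ?ltW.
  by have := lower s; have := upper s; lra.
split=> [s|r r0 xi s].
  by rewrite normq mulrC ler_pdivrMr//; exact: dq_le.
rewrite in_itv /= => /andP[sr1 sr2]; rewrite !normq.
have M0 : 0 < N / `|c| by exact: divr_gt0.
have lip x y : `|y - x| <= r -> q y <= expR (N / `|c| * r) * q x.
  move=> xyr; apply: le_trans (log_lipschitz q_der q_gt0 dq_le x y) _.
  by rewrite ler_wpM2r ?(ltW (q_gt0 x))// ler_expR ler_wpM2l// ltW.
have sr : `|s| <= r by rewrite ler_norml sr1.
split.
- rewrite ler_pdivlMr// expRN ler_pdivrMl ?expR_gt0//; apply: lip.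
  by rewrite opprD addNKr normrN.
- by rewrite ler_pdivrMr//; apply: lip; rewrite addrAC subrr add0r.
Qed.
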